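(* Let $\{(d_i,n_i,c_i),i\in\{1,\dots,I\}\}$ be the data of a polyhedral ESP in $\mathbb{R}^J$. Suppose there exist a compact, convex, symmetric set $B\subset\mathbb{R}^J$ with $0\in B^\circ$ and $\delta>0$ such that for every $i\in\{1,\dots,I\}$, $$z\in\partial B\ \text{ and }\ |\langle z,n_i\rangle|<\delta\quad\Longrightarrow\quad\langle\nu,d_i\rangle=0\ \text{ for all }\nu\in\nu(z),$$ where $\nu(z):=\{\nu\in S_1(0):\langle\nu,x-z\rangle\ge0\text{ for all }x\in B\}$ is the set of unit inward normals to $B$ at $z$. Then the associated extended Skorokhod map $\bar\Gamma$ is Lipschitz continuous on its domain of definition $\mathrm{dom}(\bar\Gamma)$.
   Context: $S_1(0)$ is the unit sphere of $\mathbb{R}^J$; symmetric means $B=-B$. Polyhedral ESP: a finite collection $(d_i,n_i,c_i)\in\mathbb{R}^J\times S_1(0)\times\mathbb{R}$, $i=1,\dots,I$, with $\langle d_i,n_i\rangle=1$; domain $G=\cap_{i}\{x\in\mathbb{R}^J:\langle x,n_i\rangle\ge c_i\}$ (assumed, as throughout the paper, to be the closure of a connected open set); $d(x)=\{0\}$ for $x\in G^\circ$ and $d(x)=\{\sum_{i\in I(x)}\alpha_id_i:\alpha_i\ge0\}$ for $x\in\partial G$, where $I(x)=\{i:\langle x,n_i\rangle=c_i\}$. $\mathcal{D}[0,\infty)$ is the space of $\mathbb{R}^J$-valued right-continuous functions with left limits on $[0,\infty)$, and $\mathcal{D}_G[0,\infty)$ the subspace of $f$ with $f(0)\in G$. Given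 $\psi\in\mathcal{D}_G[0,\infty)$, a pair $(\phi,\eta)\in\mathcal{D}_G[0,\infty)\times\mathcal{D}[0,\infty)$ solves the ESP for $\psi$ if $\phi(0)=\psi(0)$ and for all $t\ge0$: $\phi(t)=\psi(t)+\eta(t)$; $\phi(t)\in G$; $\eta(t)-\eta(s)\in\overline{\mathrm{co}}[\cup_{u\in(s,t]}d(\phi(u))]$ for every $s\in[0,t]$; and $\eta(t)-\eta(t-)\in\overline{\mathrm{co}}[d(\phi(t))]$, where $\overline{\mathrm{co}}$ is the closed convex hull. $\phi\in\bar\Gamma(\psi)$ means $(\phi,\phi-\psi)$ solves the ESP for $\psi$; $\mathrm{dom}(\bar\Gamma)$ is the set of $\psi\in\mathcal{D}_G[0,\infty)$ for which a solution exists. Lipschitz continuity on the domain means: there is a constant $\ell<\infty$ such that for all $\psi_1,\psi_2\in\mathrm{dom}(\bar\Gamma)$, $\phi_i\in\bar\Gamma(\psi_i)$ and $T<\infty$, $\sup_{t\in[0,T]}|\phi_1(t)-\phi_2(t)|\le\ell\sup_{t\in[0,T]}|\psi_1(t)-\psi_2(t)|$ (so in particular $\bar\Gamma$ is single-valued on its domain). *)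

(* Defs.v *)
From HB Require Import structures.
From mathcomp Require Import all_boot all_order all_algebra.
From mathcomp Require Import all_classical all_reals all_analysis.

Set Implicit Arguments.
Unset Strict Implicit.
Unset Printing Implicit Defensive.

Import Order.TTheory GRing.Theory Num.Theory.
Import numFieldNormedType.Exports.

Local Open Scope classical_set_scope.
Local Open Scope ring_scope.

(* The library norm `|u| on 'rV[R]_J is the sup norm, which induces the usual
   topology but not the Euclidean unit sphere; hence dotp and enorm. *)
Definition dotp (R : realType) (J : nat) (u v : 'rV[R]_J) : R :=
  \sum_(j < J) u ord0 j * v ord0 j.

Definition enorm (R : realType) (J : nat) (u : 'rV[R]_J) : R :=
  Num.sqrt (dotp u u).

Definition unit_sphere (R : realType) (J : nat) : set 'rV[R]_J :=
  [set u | enorm u = 1].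

Definition boundary (T : topologicalType) (A : set T) : set T :=
  closure A `\` interior A.

Definition symmetric_set (V : zmodType) (A : set V) : Prop :=
  A = [set - x | x in A].

Definition closed_convex_hull (R : realType) (J : nat) (A : set 'rV[R]_J) :
    set 'rV[R]_J :=
  closure (smallest (@convex_set R 'rV[R]_J) A).

Definition inward_normals (R : realType) (J : nat) (B : set 'rV[R]_J)
    (z : 'rV[R]_J) : set 'rV[R]_J :=
  [set nu | unit_sphere nu /\ forall x, B x -> 0 <= dotp nu (x - z)].

(* Paths on [0, oo) are functions on R of which only the values at nonnegative
   times are constrained or used. *)
Definition cadlag (R : realType) (J : nat) (f : R -> 'rV[R]_J) : Prop :=
  (forall t : R, 0 <= t -> f x @[x --> t^'+] --> f t) /\
  (forall t : R, 0 < t -> cvg (f x @[x --> t^'-])).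

Definition cadlag_from (R : realType) (J : nat) (G : set 'rV[R]_J)
    (f : R -> 'rV[R]_J) : Prop :=
  cadlag f /\ G (f 0).

(* f(t-), with the convention f(0-) = f(0). *)
Definition left_lim (R : realType) (J : nat) (f : R -> 'rV[R]_J) (t : R) :
    'rV[R]_J :=
  if 0 < t then lim (f x @[x --> t^'-]) else f t.

(* The increment condition is required for s < t only: for s = t the union is
   empty, and the increment 0 must not be asked to lie in the empty hull. *)
Definition esp_solution (R : realType) (J : nat) (G : set 'rV[R]_J)
    (d : 'rV[R]_J -> set 'rV[R]_J) (psi phi eta : R -> 'rV[R]_J) : Prop :=
  [/\ cadlag_from G phi, cadlag eta, phi 0 = psi 0 &
   forall t : R, 0 <= t ->
   [/\ phi t = psi t + eta t,
       G (phi t),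
       forall s : R, 0 <= s -> s < t ->
         closed_convex_hull (\bigcup_(u in `]s, t]) d (phi u)) (eta t - eta s) &
       closed_convex_hull (d (phi t)) (eta t - left_lim eta t)]].

Definition esm (R : realType) (J : nat) (G : set 'rV[R]_J)
    (d : 'rV[R]_J -> set 'rV[R]_J) (psi : R -> 'rV[R]_J) :
    set (R -> 'rV[R]_J) :=
  [set phi | esp_solution G d psi phi (phi \- psi)].

Definition esm_dom (R : realType) (J : nat) (G : set 'rV[R]_J)
    (d : 'rV[R]_J -> set 'rV[R]_J) : set (R -> 'rV[R]_J) :=
  [set psi | cadlag_from G psi /\ exists phi, esm G d psi phi].

Definition sup_dist (R : realType) (J : nat) (T : R) (f g : R -> 'rV[R]_J) :
    \bar R :=
  ereal_sup [set (enorm (f t - g t))%:E | t in `[0, T]].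

Definition esm_lipschitz (R : realType) (J : nat) (G : set 'rV[R]_J)
    (d : 'rV[R]_J -> set 'rV[R]_J) : Prop :=
  exists l : R, forall psi1 psi2 : R -> 'rV[R]_J,
    esm_dom G d psi1 -> esm_dom G d psi2 ->
    forall phi1 phi2 : R -> 'rV[R]_J,
    esm G d psi1 phi1 -> esm G d psi2 phi2 ->
    forall T : R, 0 <= T ->
    (sup_dist T phi1 phi2 <= l%:E * sup_dist T psi1 psi2)%E.

Definition polyhedron (R : realType) (J N : nat) (n : 'I_N -> 'rV[R]_J)
    (c : 'I_N -> R) : set 'rV[R]_J :=
  [set x | forall i, c i <= dotp x (n i)].

(* Empty off the polyhedron, where d is not defined. *)
Definition reflection_directions (R : realType) (J N : nat)
    (d n : 'I_N -> 'rV[R]_J) (c : 'I_N -> R) (x : 'rV[R]_J) : set 'rV[R]_J :=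
  [set v | (interior (polyhedron n c) x /\ v = 0) \/
           (boundary (polyhedron n c) x /\
            exists alpha : 'I_N -> R, (forall i, 0 <= alpha i) /\
              v = \sum_(i < N | dotp x (n i) == c i) alpha i *: d i)].

Definition polyhedral_esp_data (R : realType) (J N : nat)
    (d n : 'I_N -> 'rV[R]_J) (c : 'I_N -> R) : Prop :=
  [/\ forall i, unit_sphere (n i),
      forall i, dotp (d i) (n i) = 1 &
      exists U : set 'rV[R]_J,
        [/\ open U, connected U & polyhedron n c = closure U]].

(* Main.v *)
Require Import Defs.
From HB Require Import structures.
From mathcomp Require Import all_boot all_order all_algebra.
From mathcomp Require Import all_classical all_reals all_analysis.
From mathcomp Require Import ring lra.

Import Order.TTheory GRing.Theory Num.Theory.
Import numFieldNormedType.Exports.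

(** Let [phi1], [phi2] solve the problem for [psi1], [psi2], let
    [eta1 = phi1 - psi1] and [eta2 = phi2 - psi2] be the pushing terms, suppose
    [|psi1 - psi2| <= C] on [0, T], and choose [a] with [C < a * delta]. The
    difference [z = eta1 - eta2] cannot leave the dilated body [a B]. As
    [phi1 - phi2 = (psi1 - psi2) + z] and [B] is bounded, this is the Lipschitz
    estimate ([esm_lipschitz_of_body]).

    Why [z] is trapped: [eta1] pushes along [d i] only while [phi1] is on face
    [i]. Then [<phi1 - phi2, n i> <= 0], because [phi2] is in the polyhedron,
    so [<z, n i> <= C < a * delta]. On the part of the boundary of [a B]
    where [<z, n i> < a * delta], the direction [d i] does not point out of
    [a B]: in the strip [|<z, n i>| < a * delta] it is tangent by hypothesis,
    and below the strip convexity makes it point inwards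
    ([tangential_inward]). By symmetry of [B], the directions in which [eta2]
    pushes do not point into [a B] ([tangential_outward]), and they enter [z]
    with a minus sign.

    The pushing terms may have unbounded variation, so [z] is not integrated.
    Instead, an increment of [z] ending outside [a B] is tested against the
    inward normal at the point where the ray through its endpoint leaves [a B]
    ([increment_invariant], based on the supporting hyperplanes of
    [radial_support]). Only the active faces and the position at the end of the
    increment matter, so the same lemma treats a jump and the increments over
    short intervals to the right of a given time. These are the two steps of an
    induction along [0, T] ([real_induction]). *)

Local Open Scope classical_set_scope.
Local Open Scope ring_scope.

Set Implicit Arguments.
Unset Strict Implicit.
Unset Printing Implicit Defensive.

(** * Euclidean inner product and length *)

Section InnerProduct.
Context {R : realType} {J : nat}.
Implicit Types u v w e : 'rV[R]_J.

Lemma dotpC u v : dotp u v = dotp v u.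
Proof. by apply: eq_bigr => j _; rewrite mulrC. Qed.

Lemma dotpDr u v w : dotp u (v + w) = dotp u v + dotp u w.
Proof. by rewrite -big_split; apply: eq_bigr => j _; rewrite mxE mulrDr. Qed.

Lemma dotpZr k u v : dotp u (k *: v) = k * dotp u v.
Proof. by rewrite mulr_sumr; apply: eq_bigr => j _; rewrite mxE; ring. Qed.

Lemma dotpNr u v : dotp u (- v) = - dotp u v.
Proof. by rewrite -scaleN1r dotpZr mulN1r. Qed.

Lemma dotp0r u : dotp u 0 = 0.
Proof. by rewrite -(scale0r u) dotpZr mul0r. Qed.

Lemma dotpBr u v w : dotp u (v - w) = dotp u v - dotp u w.
Proof. by rewrite dotpDr dotpNr. Qed.

Lemma dotpDl u v w : dotp (u + v) w = dotp u w + dotp v w.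
Proof. by rewrite !(dotpC _ w) dotpDr. Qed.

Lemma dotpZl k u v : dotp (k *: u) v = k * dotp u v.
Proof. by rewrite !(dotpC _ v) dotpZr. Qed.

Lemma dotpNl u v : dotp (- u) v = - dotp u v.
Proof. by rewrite !(dotpC _ v) dotpNr. Qed.

Lemma dotpBl u v w : dotp (u - v) w = dotp u w - dotp v w.
Proof. by rewrite dotpDl dotpNl. Qed.

Lemma dotp_sumr (I : Type) (r : seq I) (P : pred I) (F : I -> 'rV[R]_J) u :
  dotp u (\sum_(i <- r | P i) F i) = \sum_(i <- r | P i) dotp u (F i).
Proof.
by apply: (big_morph (dotp u)) => [v w|]; rewrite ?dotpDr ?dotp0r.
Qed.

Lemma dotp_ge0 u : 0 <= dotp u u.
Proof. by apply: sumr_ge0 => j _; rewrite -expr2 sqr_ge0. Qed.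

Lemma dotp_eq0 u : (dotp u u == 0) = (u == 0).
Proof.
apply/idP/eqP => [|->]; last by rewrite dotp0r.
rewrite psumr_eq0 => [/allP u0|j _]; last by rewrite -expr2 sqr_ge0.
apply/rowP => j; rewrite mxE; apply/eqP.
by have := u0 j (mem_index_enum j); rewrite /= mulf_eq0 orbb.
Qed.

Lemma enorm_ge0 u : 0 <= enorm u.
Proof. exact: sqrtr_ge0. Qed.

Lemma sqr_enorm u : enorm u ^+ 2 = dotp u u.
Proof. exact/sqr_sqrtr/dotp_ge0. Qed.

Lemma enormZ k u : 0 <= k -> enorm (k *: u) = k * enorm u.
Proof.
by move=> k0; rewrite /enorm dotpZl dotpZr mulrA sqrtrM ?mulr_ge0// -expr2
  sqrtr_sqr ger0_norm.
Qed.

Lemma enormN u : enorm (- u) = enorm u.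
Proof. by rewrite /enorm dotpNl dotpNr opprK. Qed.

Lemma dotp_unit e : unit_sphere e -> dotp e e = 1.
Proof. by rewrite -sqr_enorm => ->; rewrite expr1n. Qed.

Lemma unit_sphere_normalize u : u != 0 -> unit_sphere ((enorm u)^-1 *: u).
Proof.
move=> u0; rewrite /unit_sphere/= enormZ ?invr_ge0 ?enorm_ge0// mulVf//.
by rewrite -sqrf_eq0 sqr_enorm dotp_eq0.
Qed.

(** Cauchy-Schwarz against a unit vector: the squared length of
    [u - dotp u e *: e] is [dotp u u - dotp u e ^+ 2], hence nonnegative. *)
Lemma dotp_unit_le u e : unit_sphere e -> `|dotp u e| <= enorm u.
Proof.
move=> /dotp_unit e1.
rewrite -sqrtr_sqr ler_sqrt ?dotp_ge0//.
have := dotp_ge0 (u - dotp u e *: e).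
rewrite dotpBl !dotpBr !dotpZl !dotpZr e1 (dotpC e u) => h.
rewrite -subr_ge0; apply: (le_trans h); rewrite le_eqVlt; apply/orP; left.
by apply/eqP; ring.
Qed.

(** The length of a nonzero vector is its inner product with its own
    direction, so Cauchy-Schwarz against that direction gives the triangle
    inequality. *)
Lemma enormD u v : enorm (u + v) <= enorm u + enorm v.
Proof.
have [->|uv0] := eqVneq (u + v) 0.
  by rewrite /enorm dotp0r sqrtr0 addr_ge0 ?sqrtr_ge0.
have uv1 := unit_sphere_normalize uv0; set e := _ *: (u + v) in uv1.
suff -> : enorm (u + v) = dotp u e + dotp v e.
  by rewrite lerD// (le_trans (ler_norm _))// dotp_unit_le.
rewrite -dotpDl /e dotpZr -sqr_enorm expr2 mulKf//.
by rewrite -sqrf_eq0 sqr_enorm dotp_eq0.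
Qed.

Lemma cvg_dotp {T : Type} {F : set_system T} {FF : Filter F}
    (f g : T -> 'rV[R]_J) u v :
  f x @[x --> F] --> u -> g x @[x --> F] --> v ->
  dotp (f x) (g x) @[x --> F] --> dotp u v.
Proof.
move=> fu gv.
have coord (h : T -> 'rV[R]_J) w j : h x @[x --> F] --> w ->
    h x ord0 j @[x --> F] --> w ord0 j.
  move=> hw; apply: (@cvg_comp _ _ _ h (fun m : 'rV[R]_J => m ord0 j)
    _ (nbhs w)) => //.
  exact: coord_continuous.
apply: cvg_big.
  exact: (@add_continuous R^o).
move=> j _.
by apply: cvgM; exact: coord.
Qed.

Lemma cvg_dotpl {T : Type} {F : set_system T} {FF : Filter F}
    (f : T -> 'rV[R]_J) u v :
  f x @[x --> F] --> u -> dotp (f x) v @[x --> F] --> dotp u v.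
Proof. by move=> fu; apply: (cvg_dotp fu); exact: cvg_cst. Qed.

Lemma dotp_continuous u : continuous (dotp u).
Proof.
by move=> v; apply: (@cvg_dotp _ (nbhs v) _ (fun=> u) id); [exact: cvg_cst|].
Qed.

Lemma enorm_continuous : continuous (@enorm R J).
Proof.
move=> u; apply: (@cvg_comp _ _ _ (fun v : 'rV[R]_J => dotp v v) Num.sqrt
  _ (nbhs (dotp u u))); last exact: sqrt_continuous.
exact: (@cvg_dotp _ (nbhs u) _ id id).
Qed.

End InnerProduct.

(** * Half-spaces, convex hulls and nearest points *)

Section Convex.
Context {R : realType} {J : nat}.
Implicit Types (A B : set 'rV[R]_J) (u v w x y z nu : 'rV[R]_J).

Lemma convex_set_comb B x y (t : R) : @convex_set R 'rV[R]_J B -> B x -> B y ->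
  0 <= t -> t <= 1 -> B (t *: x + (1 - t) *: y).
Proof.
move=> cB Bx By t0 t1.
by have := cB x y (Itv01 t0 t1) (mem_set Bx) (mem_set By); rewrite inE.
Qed.

Lemma closed_halfspace nu (k : R) : closed [set x | k <= dotp nu x].
Proof.
apply: (@preimage_closed _ _ (dotp nu) [set r | k <= r]).
  by move=> x _; exact: dotp_continuous.
exact: closed_ge.
Qed.

Lemma convex_halfspace nu : @convex_set R 'rV[R]_J [set x | 0 <= dotp nu x].
Proof.
move=> x y t; rewrite !inE /= => nux nuy.
by rewrite dotpDr !dotpZr addr_ge0 ?mulr_ge0 ?subr_ge0.
Qed.

(** Half-spaces are closed and convex, so a linear inequality valid for the
    reflection directions passes to increments in their closed convex hull. *)
Lemma closed_convex_hull_ge0 A nu v : (forall x, A x -> 0 <= dotp nu x) ->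
  closed_convex_hull A v -> 0 <= dotp nu v.
Proof.
move=> A0 Av; apply: (@closed_halfspace nu 0 v).
apply: closureS Av.
exact: (smallest_sub (@convex_halfspace nu)).
Qed.

(** The normal points from [w] to the nearest point [q] of [B]: if the angle
    at [q] between [w] and some [x] of [B] were acute, moving from [q] slightly towards [x] would
    come closer to [w]. *)
Lemma nearest_point_normal B w : compact B -> @convex_set R 'rV[R]_J B ->
  B !=set0 -> ~ B w ->
  exists nu, unit_sphere nu /\ forall x, B x -> 0 <= dotp nu (x - w).
Proof.
move=> cptB cvxB B0 Bw.
have [|q /set_mem Bq qmin] := @compact_EVT_min _ _
    (fun x => dotp (x - w) (x - w)) B B0 cptB.
  apply: continuous_subspaceT => x.
  have cvgw : (fun y => y - w) y @[y --> x] --> x - w.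
    by apply: (@cvgB _ _ _ (nbhs x) _ id (fun=> w) x w) => //; exact: cvg_cst.
  exact: (cvg_dotp cvgw cvgw).
have qw : q - w != 0.
  by apply/eqP => /subr0_eq qw; apply: Bw; rewrite -qw.
exists ((enorm (q - w))^-1 *: (q - w)); split.
  exact: unit_sphere_normalize.
move=> x Bx; rewrite dotpZl mulr_ge0 ?invr_ge0 ?enorm_ge0//.
rewrite -[x](subrK q) -addrA dotpDr addr_ge0 ?dotp_ge0// leNgt.
apply/negP => neg.
set p := dotp (q - w) (x - q) in neg.
pose m := dotp (x - q) (x - q).
have m0 : 0 <= m by exact: dotp_ge0.
(* The squared distance from w to the point at parameter t of the segment from
   q to x exceeds that at q by 2 t p + t^2 m. This t satisfies
   t (m - p) = - p, so the excess is t (1 + t) p < 0. *)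
pose t := - p / (m - p).
have mp : 0 < m - p by lra.
have t0 : 0 < t by rewrite divr_gt0//; lra.
have t1 : t <= 1 by rewrite ler_pdivrMr//; lra.
have := qmin _ (mem_set (convex_set_comb cvxB Bx Bq (ltW t0) t1)).
have -> : t *: x + (1 - t) *: q - w = (q - w) + t *: (x - q).
  by apply/rowP => j; rewrite !mxE; ring.
move: (q - w) (x - q) @p @m @t neg m0 mp t0 t1 => a b p m t neg m0 mp t0 t1.
rewrite dotpDr !dotpDl !dotpZl !dotpZr (dotpC b a) -/p -/m.
have -> : t * (t * m) = t * (t * (m - p)) + t * (t * p) by ring.
rewrite divfK ?gt_eqF//.
have : t * p < 0 by rewrite pmulr_rlt0.
have : t * (t * p) <= 0 by rewrite !(pmulr_rle0 _ t0) ltW.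
lra.
Qed.

Lemma compact_unit_sphere : compact (@unit_sphere R J).
Proof.
apply: bounded_closed_compact.
  exists 1; split; first exact: num_real.
  move=> M M1 u u1; apply: (le_trans _ (ltW M1)).
  rewrite /Num.norm/=.
  have [->//|/mx_norm_neq0[[i j] ->]] := eqVneq (mx_norm u) 0.
  rewrite /= (ord1 i) -(@ler_pXn2r _ 2)// ?nnegrE// expr1n.
  rewrite real_normK ?num_real//.
  rewrite -(dotp_unit u1) /dotp (bigD1 j)//= -expr2 lerDl sumr_ge0// => k _.
  by rewrite -expr2 sqr_ge0.
apply: (@preimage_closed _ _ (@enorm R J) [set r | r = 1]).
  by move=> x _; exact: enorm_continuous.
exact: closed_eq.
Qed.

End Convex.

(** * Supporting hyperplanes of a convex body *)

Section Support.
Context {R : realType} {J : nat}.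
Implicit Types (A B : set 'rV[R]_J) (u v w x y z nu : 'rV[R]_J).

Lemma interior_segment B x v : interior B x ->
  \forall t \near 0^'+, B (x + t *: v).
Proof.
move=> Bx.
have : x + t *: v @[t --> (0 : R)^'+] --> x.
  apply: cvg_at_right_filter; rewrite -[X in _ --> X]addr0 -(scale0r v).
  by apply: cvgD; [exact: cvg_cst|apply: cvgZr_tmp; exact: cvg_id].
exact.
Qed.

Lemma last_radius B w : compact B -> B 0 -> ~ B w ->
  exists s : R, [/\ 0 <= s, s < 1, B (s *: w) &
    forall r, s < r -> r <= 1 -> ~ B (r *: w)].
Proof.
move=> cptB B0 Bw.
pose E := `[(0 : R), 1] `&` [set r | B (r *: w)].
have cptE : compact E.
  apply: compact_closedI; first exact: segment_compact.
  apply: (@preimage_closed _ _ (fun r : R => r *: w) B).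
    by move=> r _; apply: cvgZr_tmp; exact: cvg_id.
  by apply: compact_closed => //; exact: norm_hausdorff.
have [||s /set_mem[/=]] := @compact_EVT_max _ _ id E _ cptE.
- by exists 0; split; rewrite /= ?in_itv/= ?lexx ?ler01// scale0r.
- by apply: continuous_subspaceT => r; exact: cvg_id.
rewrite in_itv/= => /andP[s0 s1] Bs smax.
have s1' : s < 1.
  by rewrite lt_neqAle s1 andbT; apply/eqP => s1'; apply: Bw;
     rewrite -(scale1r w) -s1'.
exists s; split => // r sr r1 Br.
have Er : E r by split => //=; rewrite in_itv/= r1 andbT (le_trans s0)// ltW.
by have := smax r (mem_set Er); rewrite /= leNgt sr.
Qed.

Lemma cluster_closed {T : topologicalType} (F : set_system T) (p : T)
    (C : set T) : Filter F -> cluster F p -> closed C -> F C -> C p.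
Proof.
move=> FF; rewrite cluster_cvgE => -[G GG [Gp FG]] clC FC.
by apply: (closed_cvg (F := G) (u_ := id) _ clC) Gp; exact: FG.
Qed.

(** Leaving [y] in the direction opposite to an inward normal leaves [B] at
    once. *)
Lemma inward_normal_boundary B y nu : B y -> inward_normals B y nu ->
  boundary B y.
Proof.
move=> By [nu1 nuB]; split; first exact: subset_closure.
move=> /(interior_segment (- nu)) int_y.
have [r [Br r0]] := filter_ex (filterI int_y (nbhs_right_gt 0)).
have := nuB _ Br; rewrite addrC addKr dotpZr dotpNr (dotp_unit nu1).
by move: r0; rewrite /=; lra.
Qed.

(** Supporting hyperplane at the point where the segment from [0] to [w] leaves
    [B]. The points [r *: w] with [r] slightly larger than [s] lie outside [B]
    and are separated from it by their nearest points; as [r] decreases to [s],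
    compactness of the sphere yields a limiting normal. Since [0] is interior,
    that normal is strictly negative on [w] and [s] is positive. *)
Lemma radial_support B w : compact B -> @convex_set R 'rV[R]_J B ->
  interior B 0 -> ~ B w ->
  exists (s : R) nu, [/\ 0 < s, s < 1, boundary B (s *: w),
    inward_normals B (s *: w) nu & dotp nu w < 0].
Proof.
move=> cptB cvxB int0 Bw.
have B0 : B 0 by exact: interior_subset.
have [s [s0 s1 Bs Brw]] := last_radius cptB B0 Bw.
have /choice[nus nusP] : forall r : R, exists nu, s < r -> r < 1 ->
    unit_sphere nu /\ forall x, B x -> 0 <= dotp nu (x - r *: w).
  move=> r; have [/andP[sr r1]|] := boolP (s < r < 1).
    have [|nu nuP] := nearest_point_normal cptB cvxB _ (Brw r sr (ltW r1)).
      by exists 0.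
    by exists nu.
  by move=> nsr; exists 0 => sr r1; rewrite sr r1 in nsr.
have near_s : \forall r \near s^'+, s < r /\ r < 1.
  by near=> r; split; near: r; [exact: nbhs_right_gt|exact: nbhs_right_lt].
pose F := nus r @[r --> s^'+].
have [|nu [nu1 nuF]] := @compact_unit_sphere R J F _.
  by apply: filterS near_s => r [sr r1]; have [] := nusP r sr r1.
have nuB x : B x -> 0 <= dotp nu (x - s *: w).
  move=> Bx; rewrite leNgt; apply/negP => neg.
  pose e := - dotp nu (x - s *: w) / 2.
  have e0 : 0 < e by rewrite /e; lra.
  suff : - e <= dotp nu (x - s *: w) by rewrite /e; lra.
  rewrite dotpC; apply: (cluster_closed _ nuF
    (@closed_halfspace R J (x - s *: w) (- e))).
  have we : 0 < e / (enorm w + 1).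
    by rewrite divr_gt0// ltr_wpDl// enorm_ge0.
  have near_e : \forall r \near s^'+, r - s < e / (enorm w + 1).
    exact: nbhs_right_ltDr.
  apply: filterS2 near_s near_e => r [sr r1] re /=.
  have [nur1 /(_ _ Bx) nurx] := nusP r sr r1.
  rewrite dotpC -[x - _](_ : (x - r *: w) + (r - s) *: w = _); last first.
    by rewrite scalerBl addrA subrK.
  rewrite dotpDr dotpZr -[leLHS]add0r lerD// lerNl -mulrN.
  move: re; rewrite ltr_pdivlMr ?ltr_wpDl ?enorm_ge0// => /ltW; apply: le_trans.
  rewrite ler_wpM2l ?subr_ge0 ?(ltW sr)//.
  rewrite -dotpNl dotpC (le_trans (ler_norm _))// dotpNr normrN.
  by rewrite (le_trans (dotp_unit_le _ nur1))// lerDl.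
(* A short step from 0 against nu stays in B; testing nu there gives the strict
   sign of nu on w. *)
have [t [t0 Bt]] : exists t : R, 0 < t /\ B (- (t *: nu)).
  have [t [Bt t0]] := @filter_ex _ (0^'+) _ _
    (filterI (interior_segment (- nu) int0) (nbhs_right_gt 0)).
  by exists t; rewrite -scalerN -[_ *: _]add0r.
have nuw : s * dotp nu w < 0.
  by have := nuB _ Bt; rewrite dotpBr dotpNr !dotpZr (dotp_unit nu1); lra.
have s0' : 0 < s.
  rewrite lt_neqAle s0 andbT; apply/eqP => s00.
  by rewrite -s00 mul0r ltxx in nuw.
exists s, nu; split => //; last by rewrite pmulr_rlt0 in nuw.
by apply: inward_normal_boundary Bs _; split; [exact: nu1|exact: nuB].
Unshelve. all: by end_near. Qed.

End Support.

(** * Increments that cannot leave a dilated body *)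

Section Invariance.
Context {R : realType} {J : nat} (B : set 'rV[R]_J) (delta : R).
Hypothesis cptB : compact B.
Hypothesis cvxB : @convex_set R 'rV[R]_J B.
Hypothesis symB : symmetric_set B.
Hypothesis int0 : interior B 0.
Hypothesis delta_gt0 : 0 < delta.

Let closedB : closed B.
Proof. by apply: compact_closed => //; exact: norm_hausdorff. Qed.

Let symBN y : B y -> B (- y).
Proof. by move=> By; rewrite symB; exists y. Qed.

(** The condition on [B], for one reflection direction and its face normal. *)
Definition tangential (d n : 'rV[R]_J) := forall z, boundary B z ->
  `|dotp z n| < delta -> forall nu, inward_normals B z nu -> dotp nu d = 0.

(** Along the line [y + r *: d] the gauge of [B] is minimal on the hyperplane
    [dotp _ n = 0], because there the boundary of [B] is parallel to [d].
    When [dotp y n <= - delta], going from [y] in the direction [d] leads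
    towards that hyperplane, that is, into [B]. *)
Lemma tangential_inward d n y nu : dotp d n = 1 -> tangential d n ->
  boundary B y -> dotp y n < delta -> inward_normals B y nu ->
  0 <= dotp nu d.
Proof.
move=> dn1 tan_dn bdy yn nuy.
have By : B y by exact: closedB bdy.1.
have [yn_small|] := ltP `|dotp y n| delta; first by rewrite (tan_dn y).
rewrite real_lter_normr ?num_real// => /orP[|yn_neg]; first lra.
pose w := y - dotp y n *: d.
have wn0 : dotp w n = 0 by rewrite dotpBl dotpZl dn1 mulr1 subrr.
have [Bw|Bw] := pselect (B w).
  have := nuy.2 w Bw.
  have -> : w - y = - dotp y n *: d by rewrite /w addrC addKr scaleNr.
  by rewrite dotpZr pmulr_rge0//; lra.
(* Were w outside B, the hyperplane supporting B on the ray through w would be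
   parallel to d, so it would separate y from B as well. *)
have [s [mu [s0 s1 bdw muw muw0]]] := radial_support cptB cvxB int0 Bw.
have mud : dotp mu d = 0.
  by apply: (tan_dn _ bdw) muw; rewrite dotpZl wn0 mulr0 normr0.
have muyw : dotp mu y = dotp mu w by rewrite /w dotpBr dotpZr mud mulr0 subr0.
have := muw.2 _ By; rewrite dotpBr dotpZr muyw => h.
suff : s * dotp mu w > dotp mu w by lra.
by nra.
Qed.

Lemma tangential_outward d n y nu : dotp d n = 1 -> tangential d n ->
  boundary B y -> - delta < dotp y n -> inward_normals B y nu ->
  dotp nu d <= 0.
Proof.
move=> dn1 tan_dn bdy yn [nu1 nuB].
have nuN : inward_normals B (- y) (- nu).
  split=> [|x Bx]; first by rewrite /unit_sphere/= enormN.
  by rewrite opprK dotpNl -dotpNr opprD; exact: (nuB _ (symBN Bx)).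
rewrite -oppr_ge0 -dotpNl; apply: (tangential_inward dn1 tan_dn _ _ nuN).
  by apply: (inward_normal_boundary _ nuN); apply/symBN/closedB; exact: bdy.1.
by rewrite dotpNl; lra.
Qed.

(** Call [nu] an inward normal of [B] where the ray through [z1] leaves it. If
    [a^-1 *: z1] were outside [B], then [z1] would lie strictly further out than
    [z0] in the direction [- nu]. But [z1 - z0] consists of directions [d i]
    that point inwards at that place, minus directions that point outwards.
    The hypotheses on [A1] and [A2] constrain the scalar products at [z1]
    only, so that jumps and small increments are covered alike. *)
Lemma increment_invariant (N : nat) (d n : 'I_N -> 'rV[R]_J) (a : R)
    (A1 A2 : set 'rV[R]_J) (z0 z1 v1 v2 : 'rV[R]_J) :
  (forall i, dotp (d i) (n i) = 1) -> (forall i, tangential (d i) (n i)) ->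
  0 < a ->
  (forall nu v, A1 v ->
    (forall i, dotp z1 (n i) < a * delta -> 0 <= dotp nu (d i)) ->
    0 <= dotp nu v) ->
  (forall nu v, A2 v ->
    (forall i, - (a * delta) < dotp z1 (n i) -> 0 <= dotp nu (d i)) ->
    0 <= dotp nu v) ->
  closed_convex_hull A1 v1 -> closed_convex_hull A2 v2 ->
  z1 - z0 = v1 - v2 -> B (a^-1 *: z0) -> B (a^-1 *: z1).
Proof.
move=> dn1 tan_dn a0 A1P A2P Av1 Av2 z10 Bz0; apply: contrapT => Bz1.
have [s [nu [s0 s1 bdw nuw nuw0]]] := radial_support cptB cvxB int0 Bz1.
have sn i : dotp (s *: (a^-1 *: z1)) (n i) = s * (dotp z1 (n i) / a).
  by rewrite !dotpZl (mulrC a^-1).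
have nuv1 : 0 <= dotp nu v1.
  apply: closed_convex_hull_ge0 Av1 => v Av; apply: A1P Av _ => i zi.
  apply: (tangential_inward (dn1 i) (tan_dn i) bdw) nuw; rewrite sn.
  have : dotp z1 (n i) / a < delta by rewrite ltr_pdivrMr// mulrC.
  by move: (_ / a) delta_gt0 => q; nra.
have nuv2 : 0 <= dotp (- nu) v2.
  apply: closed_convex_hull_ge0 Av2 => v Av; apply: A2P Av _ => i zi.
  rewrite dotpNl oppr_ge0.
  apply: (tangential_outward (dn1 i) (tan_dn i) bdw) nuw; rewrite sn.
  have : - delta < dotp z1 (n i) / a by rewrite ltr_pdivlMr// mulNr mulrC.
  by move: (_ / a) delta_gt0 => q; nra.
have nuz : 0 <= dotp nu (z1 - z0).
  by rewrite z10 dotpBr; move: nuv2; rewrite dotpNl; lra.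
have := nuw.2 _ Bz0.
have : s * dotp nu (a^-1 *: z1) > dotp nu (a^-1 *: z1) by nra.
rewrite dotpBr (dotpZr s).
have : dotp nu (a^-1 *: z0) <= dotp nu (a^-1 *: z1).
  rewrite !dotpZr ler_wpM2l ?invr_ge0 ?(ltW a0)//.
  by move: nuz; rewrite dotpBr subr_ge0.
lra.
Qed.

End Invariance.

(** * Induction along an interval and active faces *)

Section RealInduction.
Context {R : realType}.

Lemma near_at_rightP (t : R) (P : R -> Prop) :
  (\forall s \near t^'+, P s) <->
  exists2 e, 0 < e & forall s, t < s -> s < t + e -> P s.
Proof.
split=> [[e /= e0 eP]|[e e0 eP]].
  exists e => // s ts ste; apply: eP => //=.
  by rewrite distrC ger0_norm ?subr_ge0 ?(ltW ts)// ltrBlDl.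
near=> s; apply: eP; near: s; first exact: nbhs_right_gt.
by apply: nbhs_right_lt; rewrite ltrDl.
Unshelve. all: by end_near. Qed.

Lemma near_at_right_interval (t : R) (P : R -> Prop) :
  (\forall s \near t^'+, P s) ->
  \forall s \near t^'+, forall u, t < u -> u <= s -> P u.
Proof.
move=> /near_at_rightP[e e0 eP]; apply/near_at_rightP.
exists e => // s ts ste u tu us.
by apply: eP => //; exact: le_lt_trans ste.
Qed.

(** Induction along an interval: the infimum of the set of counterexamples
    satisfies [P] by the first step and is not an infimum by the second. *)
Lemma real_induction (T : R) (P : R -> Prop) : P 0 ->
  (forall t, 0 < t -> t <= T -> (forall s, 0 <= s -> s < t -> P s) -> P t) ->
  (forall t, 0 <= t -> t < T -> P t -> \forall s \near t^'+, P s) ->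
  forall t, 0 <= t -> t <= T -> P t.
Proof.
move=> P0 Pleft Pright t t0 tT; apply: contrapT => nPt.
pose E := [set s | [/\ 0 <= s, s <= T & ~ P s]].
have Et : E t by [].
have lbE : lbound E 0 by move=> s [].
have infE : has_inf E by split; [exists t|exists 0].
have inf0 : 0 <= inf E by apply: lb_le_inf => //; exists t.
have inft : inf E <= t by apply: ge_inf => //; exists 0.
have before s : 0 <= s -> s < inf E -> P s.
  move=> s0 sE; apply: contrapT => nPs; move: (sE); rewrite ltNge ge_inf//.
    by exists 0.
  by split => //; exact: ltW (lt_le_trans sE (le_trans inft tT)).
have Pinf : P (inf E).
  have [<-//|infE_gt0] := eqVneq 0 (inf E).
  by apply: Pleft => //; [rewrite lt_neqAle infE_gt0|exact: le_trans tT].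
have infT : inf E < T.
  rewrite lt_neqAle (le_trans inft tT) andbT; apply/eqP => ET; apply: nPt.
  by have -> : t = inf E by apply/eqP; rewrite eq_le inft ET tT.
have /near_at_rightP[e e0 eP] := Pright _ inf0 infT Pinf.
have [s [s0 sT nPs] sE] := inf_adherent e0 infE.
apply: (nPs); have [->//|sinf] := eqVneq s (inf E).
apply: eP => //; rewrite lt_neqAle eq_sym sinf/= ge_inf//; first by exists 0.
Qed.

End RealInduction.

Section Paths.
Context {R : realType} {J N : nat}.
Variables (d n : 'I_N -> 'rV[R]_J) (c : 'I_N -> R).
Implicit Types (x y v nu : 'rV[R]_J) (psi phi eta : R -> 'rV[R]_J).

Lemma reflection_directions_ge0 x v nu :
  reflection_directions d n c x v ->
  (forall i, dotp x (n i) = c i -> 0 <= dotp nu (d i)) ->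
  0 <= dotp nu v.
Proof.
move=> [[_ ->] _|[_ [alpha [alpha0 ->]]] face0]; first by rewrite dotp0r.
rewrite dotp_sumr sumr_ge0// => i /eqP xi.
by rewrite dotpZr mulr_ge0// face0.
Qed.

(** The faces are closed, so just after time [t] a right-continuous path meets
    only faces that contain [phi t]. *)
Lemma right_active_faces phi t : phi u @[u --> t^'+] --> phi t ->
  \forall s \near t^'+, forall u, t < u -> u <= s ->
    forall i, dotp (phi u) (n i) = c i -> dotp (phi t) (n i) = c i.
Proof.
move=> phit; apply: near_at_right_interval; apply: filter_forall => i.
have [->|neq] := eqVneq (dotp (phi t) (n i)) (c i).
  by apply: filterE.
have near_neq : \forall u \near t^'+, dotp (phi u) (n i) != c i.
  apply: (@cvg_dotpl _ _ _ _ _ _ _ (n i) phit [set r | r != c i]).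
  by apply: open_nbhs_nbhs; split; [exact: open_neq|].
by apply: filterS near_neq => u /eqP.
Qed.

(** For [v] the normal of a face containing [x1], every point [x2] of the
    polyhedron satisfies the last hypothesis. *)
Lemma dotp_gap_le x1 x2 y1 y2 v C :
  unit_sphere v -> enorm (y1 - y2) <= C -> dotp x1 v <= dotp x2 v ->
  dotp ((x1 - y1) - (x2 - y2)) v <= C.
Proof.
move=> v1 yC x12.
have -> : (x1 - y1) - (x2 - y2) = (x1 - x2) - (y1 - y2).
  by apply/rowP => j; rewrite !mxE; ring.
have := dotp_unit_le (y1 - y2) v1; rewrite ler_norml => /andP[yv _].
by move: x12; rewrite dotpBl (dotpBl x1); lra.
Qed.

End Paths.

(** * Lipschitz continuity *)

Section Main.
Context {R : realType} {J N : nat}.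
Variables (d n : 'I_N -> 'rV[R]_J) (c : 'I_N -> R).
Variables (B : set 'rV[R]_J) (delta : R).
Hypothesis n1 : forall i, unit_sphere (n i).
Hypothesis dn1 : forall i, dotp (d i) (n i) = 1.
Hypothesis cptB : compact B.
Hypothesis cvxB : @convex_set R 'rV[R]_J B.
Hypothesis symB : symmetric_set B.
Hypothesis int0 : interior B 0.
Hypothesis delta_gt0 : 0 < delta.
Hypothesis tan_dn : forall i, tangential B delta (d i) (n i).

Let closedB : closed B.
Proof. by apply: compact_closed => //; exact: norm_hausdorff. Qed.

Let G := polyhedron n c.
Let D := reflection_directions d n c.

Section TwoSolutions.
Variables (psi1 psi2 phi1 phi2 : R -> 'rV[R]_J) (T C a : R).
Hypothesis sol1 : esm G D psi1 phi1.
Hypothesis sol2 : esm G D psi2 phi2.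
Hypothesis psiC : forall t, 0 <= t -> t <= T -> enorm (psi1 t - psi2 t) <= C.
Hypothesis a_gt0 : 0 < a.
Hypothesis Ca : C < a * delta.

Let eta1 := phi1 \- psi1.
Let eta2 := phi2 \- psi2.
Let z t := eta1 t - eta2 t.

Let z_face1 t i : 0 <= t -> t <= T -> dotp (phi1 t) (n i) = c i ->
  dotp (z t) (n i) < a * delta.
Proof.
move=> t0 tT facei; apply: le_lt_trans Ca.
have [_ _ _ /(_ _ t0)[_ Gphi2 _ _]] := sol2.
by apply: dotp_gap_le (psiC t0 tT) _; rewrite // facei; exact: Gphi2.
Qed.

Let z_face2 t i : 0 <= t -> t <= T -> dotp (phi2 t) (n i) = c i ->
  - (a * delta) < dotp (z t) (n i).
Proof.
move=> t0 tT facei; rewrite ltrNl -dotpNl opprB; apply: le_lt_trans Ca.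
have [_ _ _ /(_ _ t0)[_ Gphi1 _ _]] := sol1.
apply: dotp_gap_le; rewrite // ?facei; last exact: Gphi1.
by rewrite -opprB enormN; exact: psiC.
Qed.

(** The jump at [t] is made of directions active at [t] itself, whatever the
    paths did before. *)
Let z_jump t : 0 < t -> t <= T ->
  (forall s, 0 <= s -> s < t -> B (a^-1 *: z s)) -> B (a^-1 *: z t).
Proof.
move=> t0 tT before.
have [_ [_ left1] _ /(_ _ (ltW t0))[_ _ _ jump1]] := sol1.
have [_ [_ left2] _ /(_ _ (ltW t0))[_ _ _ jump2]] := sol2.
apply: (increment_invariant cptB cvxB symB int0 delta_gt0 dn1 tan_dn a_gt0
  _ _ jump1 jump2 (z0 := left_lim eta1 t - left_lim eta2 t)).
- move=> nu v /reflection_directions_ge0 + nu_d; apply => i facei.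
  by apply: nu_d; apply: z_face1 => //; exact: ltW.
- move=> nu v /reflection_directions_ge0 + nu_d; apply => i facei.
  by apply: nu_d; apply: z_face2 => //; exact: ltW.
- by apply/rowP => j; rewrite !mxE; ring.
rewrite /left_lim t0.
have cvgz : a^-1 *: z s @[s --> t^'-] -->
    a^-1 *: (lim (eta1 s @[s --> t^'-]) - lim (eta2 s @[s --> t^'-])).
  by apply: cvgZl_tmp; apply: cvgB; [exact: left1|exact: left2].
apply: (closed_cvg _ closedB _ _ cvgz).
near=> s; apply: before; near: s; last exact: nbhs_left_lt.
exact: nbhs_left_ge.
Unshelve. all: by end_near. Qed.

(** Shortly after [t] only faces active at [t] can push, and for these the
    bounds on [dotp (z t) (n i)] persist by right-continuity. *)
Let z_right t : 0 <= t -> t < T -> B (a^-1 *: z t) ->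
  \forall s \near t^'+, B (a^-1 *: z s).
Proof.
move=> t0 tT Bzt; have tT' := ltW tT.
have [[[right_phi1 _] _] [right1 _] _ incr1] := sol1.
have [[[right_phi2 _] _] [right2 _] _ incr2] := sol2.
have cvgz i : dotp (z s) (n i) @[s --> t^'+] --> dotp (z t) (n i).
  by apply: cvg_dotpl; apply: cvgB; [exact: right1|exact: right2].
have near1 : \forall s \near t^'+, forall i,
    dotp (phi1 t) (n i) = c i -> dotp (z s) (n i) < a * delta.
  apply: filter_forall => i.
  have [facei|nface] := pselect (dotp (phi1 t) (n i) = c i).
    by apply: filterS (cvgr_lt _ (cvgz i) _ (z_face1 t0 tT' facei)) => s zs _.
  by apply: filterE => s /nface.
have near2 : \forall s \near t^'+, forall i,
    dotp (phi2 t) (n i) = c i -> - (a * delta) < dotp (z s) (n i).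
  apply: filter_forall => i.
  have [facei|nface] := pselect (dotp (phi2 t) (n i) = c i).
    by apply: filterS (cvgr_gt _ (cvgz i) _ (z_face2 t0 tT' facei)) => s zs _.
  by apply: filterE => s /nface.
have act1 := right_active_faces n c (right_phi1 _ t0).
have act2 := right_active_faces n c (right_phi2 _ t0).
near=> s.
have ts : t < s by near: s; exact: nbhs_right_gt.
have s0 : 0 <= s by rewrite (le_trans t0)// ltW.
have [_ _ /(_ _ t0 ts) hull1 _] := incr1 _ s0.
have [_ _ /(_ _ t0 ts) hull2 _] := incr2 _ s0.
apply: (increment_invariant cptB cvxB symB int0 delta_gt0 dn1 tan_dn a_gt0
  _ _ hull1 hull2 _ Bzt).
- move=> nu v [u /= + uv]; rewrite in_itv/= => /andP[tu us] nu_d.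
  apply: (reflection_directions_ge0 uv) => i facei; apply: nu_d.
  by apply: (near near1 s) => //; apply: (near act1 s) facei.
- move=> nu v [u /= + uv]; rewrite in_itv/= => /andP[tu us] nu_d.
  apply: (reflection_directions_ge0 uv) => i facei; apply: nu_d.
  by apply: (near near2 s) => //; apply: (near act2 s) facei.
by apply/rowP => j; rewrite !mxE; ring.
Unshelve. all: by end_near. Qed.

Lemma pushing_difference_bound t : 0 <= t -> t <= T -> B (a^-1 *: z t).
Proof.
apply: (@real_induction _ T (fun t => B (a^-1 *: z t)) _ z_jump z_right).
have [_ _ phi10 _] := sol1; have [_ _ phi20 _] := sol2.
rewrite /z /eta1 /eta2 /= phi10 phi20 !subrr scaler0.
exact: interior_subset.
Qed.

End TwoSolutions.

(** With [M] a bound of the length on [B] and [a := 2 * C / delta], the pushing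
    terms differ by at most [a * M], which makes [1 + 2 * M / delta] a Lipschitz
    constant. *)
Lemma esm_lipschitz_of_body : esm_lipschitz G D.
Proof.
have B0 : B !=set0 by exists 0; exact: interior_subset.
have [q /set_mem _ qmax] := compact_EVT_max B0 cptB
  (continuous_subspaceT (@enorm_continuous R J)).
pose M := enorm q.
have BM x : B x -> enorm x <= M by move=> Bx; exact: qmax (mem_set Bx).
have M0 : 0 <= M by exact: enorm_ge0.
pose l := 1 + 2 * M / delta.
have l0 : 0 < l by rewrite ltr_pwDl// divr_ge0 ?mulr_ge0// ltW.
have bound psi1 psi2 phi1 phi2 T C : esm G D psi1 phi1 -> esm G D psi2 phi2 ->
    (forall t, 0 <= t -> t <= T -> enorm (psi1 t - psi2 t) <= C) -> 0 < C ->
    forall t, 0 <= t -> t <= T -> enorm (phi1 t - phi2 t) <= l * C.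
  move=> sol1 sol2 psiC C0 t t0 tT.
  pose a := 2 * C / delta.
  have a0 : 0 < a by rewrite divr_gt0// mulr_gt0.
  have Ca : C < a * delta by rewrite divfK ?gt_eqF//; lra.
  have /BM := pushing_difference_bound sol1 sol2 psiC a0 Ca t0 tT.
  rewrite enormZ ?invr_ge0 ?(ltW a0)// ler_pdivrMl//= => zM.
  have -> : phi1 t - phi2 t =
      (psi1 t - psi2 t) + ((phi1 t - psi1 t) - (phi2 t - psi2 t)).
    by apply/rowP => j; rewrite !mxE; ring.
  apply: le_trans (enormD _ _) _.
  apply: le_trans (lerD (psiC t t0 tT) zM) _.
  rewrite le_eqVlt; apply/orP; left; apply/eqP.
  by rewrite /l /a; field; rewrite gt_eqF.
(* The bound needs C > 0, while the supremum may vanish or be infinite. *)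
exists l => psi1 psi2 _ _ phi1 phi2 sol1 sol2 T T0.
have sup_ge t : 0 <= t -> t <= T ->
    ((enorm (psi1 t - psi2 t))%:E <= sup_dist T psi1 psi2)%E.
  move=> t0 tT; apply: ereal_sup_ubound; exists t => //=.
  by rewrite in_itv/= t0.
have := sup_ge 0 (lexx 0) T0.
move: sup_ge; case: (sup_dist T psi1 psi2) => [S||] sup_ge // S0.
- have {S0}S0 : 0 <= S by rewrite -lee_fin (le_trans _ S0)// lee_fin enorm_ge0.
  apply: ge_ereal_sup => _ [t /= + <-]; rewrite in_itv/= => /andP[t0 tT].
  rewrite -EFinM lee_fin; apply/ler_addgt0Pr => e e0.
  have -> : l * S + e = l * (S + e / l).
    by rewrite mulrDr mulrCA divff ?mulr1// gt_eqF.
  apply: bound sol1 sol2 _ _ _ t0 tT; last by rewrite ltr_wpDl// divr_gt0.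
  move=> u u0 uT; apply: (@le_trans _ _ S).
    by have := sup_ge u u0 uT; rewrite lee_fin.
  by rewrite lerDl ltW// divr_gt0.
- by rewrite gt0_muley ?lte_fin// leey.
Qed.

End Main.

Unset Implicit Arguments.

Theorem theorem3p3 (R : realType) (J N : nat)
    (d n : 'I_N -> 'rV[R]_J) (c : 'I_N -> R)
    (Hdata : polyhedral_esp_data d n c)
    (HB : exists (B : set 'rV[R]_J) (delta : R),
      [/\ compact B, convex_set B, symmetric_set B & interior B 0] /\
      0 < delta /\
      forall (i : 'I_N) (z : 'rV[R]_J),
        boundary B z -> `|dotp z (n i)| < delta ->
        forall nu, inward_normals B z nu -> dotp nu (d i) = 0) :
  esm_lipschitz (polyhedron n c) (reflection_directions d n c).
Proof.
have [n1 dn1 _] := Hdata.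
have [B [delta [[cptB cvxB symB int0] [delta_gt0 tan_dn]]]] := HB.
exact: (esm_lipschitz_of_body c n1 dn1 cptB cvxB symB int0 delta_gt0 tan_dn).
Qed.
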